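(* For every integer $n\geq 2$, the Gutman index of the pentagonal Möbius chain $P'_n$ is \[\operatorname{Gut}(P'_n)=\begin{cases}49n^3+64n^2-13n, & n \text{ even},\\ 49n^3+64n^2-14n, & n \text{ odd}.\end{cases}\]
   Context: For $n\geq 2$, $P'_n$ has vertex set $\{u_1,\dots,u_{2n}\}\cup\{u'_1,\dots,u'_{2n}\}\cup\{w_1,\dots,w_n\}$ and edges $u_ku_{k+1}$, $u'_ku'_{k+1}$ ($1\le k\le 2n-1$), $u_{2n}u'_1$, $u'_{2n}u_1$, $u_{2k-1}u'_{2k-1}$ ($1\le k\le n$), and $u_{2k}w_k$, $w_ku'_{2k}$ ($1\le k\le n$). For a connected graph with vertices $v_1,\dots,v_N$, degrees $d_i$ and shortest-path distances $d_{ij}$, the Gutman index is $\operatorname{Gut}(G)=\frac12\sum_{i=1}^N\sum_{j=1}^N d_id_jd_{ij}$. *)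

(* Defs.v *)
From mathcomp Require Import all_boot all_order all_algebra.

Set Implicit Arguments.
Unset Strict Implicit.
Unset Printing Implicit Defensive.

Import GRing.Theory.
Local Open Scope ring_scope.

Record sgraph := SGraph {
  vertex :> finType;
  adj : rel vertex;
  adj_sym : symmetric adj;
  adj_irrefl : irreflexive adj }.

Definition connected (G : sgraph) : bool :=
  [forall x : G, forall y : G, connect (@adj G) x y].

Definition deg (G : sgraph) (x : G) : nat := #|[set y | adj x y]|.

Definition walk (G : sgraph) (k : nat) (x y : G) : bool :=
  [exists p : k.-tuple G, path (@adj G) x p && (last x p == y)].

(* The least length of a walk from x to y. A shortest walk repeats no vertex,
   so lengths below #|G| suffice; the value is the junk #|G| when y is not
   reachable from x. See [distP]. *)
Definition dist (G : sgraph) (x y : G) : nat :=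
  find (fun k => walk k x y) (iota 0 #|G|).

(* Meaningful for connected G only. *)
Definition gutman (G : sgraph) : rat :=
  2^-1 * \sum_(x : G) \sum_(y : G) (deg x * deg y * dist x y)%:R.

Lemma distP (G : sgraph) (x y : G) : connect (@adj G) x y ->
  walk (dist x y) x y /\ forall k, walk k x y -> (dist x y <= k)%N.
Proof.
move=> /connectP[p pth ->]; case/shortenP: pth => q pth uq _.
set z := last x q.
have wq : walk (size q) x z.
  by apply/existsP; exists (in_tuple q); rewrite /= pth eqxx.
have szq : (size q < #|G|)%N by have := max_card (mem (x :: q)); rewrite (card_uniqP uq).
have hw : has (fun k => walk k x z) (iota 0 #|G|).
  by apply/hasP; exists (size q); rewrite ?mem_iota.
have dlt : (dist x z < #|G|)%N by move: hw; rewrite has_find size_iota.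
split; first by have /= := nth_find 0%N hw; rewrite nth_iota.
move=> k wk; rewrite leqNgt; apply/negP => lt_k.
have := before_find 0%N lt_k.
by rewrite nth_iota ?(ltn_trans lt_k dlt) //= add0n wk.
Qed.

(* Left to right, the summands hold the u_k, the u'_k and the w_k. *)
Definition moebius_vertex (n : nat) : Type := ('I_n.*2 + 'I_n.*2 + 'I_n)%type.

Local Notation U i := (inl (inl i)).
Local Notation U' i := (inl (inr i)).
Local Notation W i := (inr i).

(* Ordinals count from 0, while the subscripts of u, u' and w start at 1. *)
Definition subscript (m : nat) (i : 'I_m) : nat := i.+1.

(* Each edge of P'_n, oriented in the order in which its ends are written:
   u_k u_(k+1), u_(2n) u'_1, u_(2k-1) u'_(2k-1), u'_k u'_(k+1), u'_(2n) u_1,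
   u_(2k) w_k and w_k u'_(2k). *)
Definition moebius_arc (n : nat) (x y : moebius_vertex n) : bool :=
  match x, y with
  | U i, U j => subscript j == (subscript i).+1
  | U i, U' j => (subscript i == n.*2) && (subscript j == 1%N)
                 || odd (subscript i) && (subscript j == subscript i)
  | U' i, U' j => subscript j == (subscript i).+1
  | U' i, U j => (subscript i == n.*2) && (subscript j == 1%N)
  | U i, W k => subscript i == (subscript k).*2
  | W k, U' j => subscript j == (subscript k).*2
  | _, _ => false
  end.

Definition moebius_adj (n : nat) : rel (moebius_vertex n) :=
  fun x y => moebius_arc x y || moebius_arc y x.

Lemma moebius_adj_sym n : symmetric (@moebius_adj n).
Proof. by move=> x y; rewrite /moebius_adj orbC. Qed.

Lemma moebius_adj_irrefl n : irreflexive (@moebius_adj n).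
Proof.
by move=> [[i|i]|i]; rewrite /moebius_adj //= orbb ltn_eqF.
Qed.

Definition pentagonal_moebius (n : nat) : sgraph :=
  SGraph (@moebius_adj_sym n) (@moebius_adj_irrefl n).

Lemma pentagonal_moebius_connected n : connected (pentagonal_moebius n).
Proof.
case: n => [|n].
  by apply/forallP => -[[[]|[]]|[]].
have csym : connect_sym (@moebius_adj n.+1).
  exact: sym_connect_sym (@moebius_adj_sym n.+1).
have n2 : (0 < n.+1.*2)%N by [].
pose o : moebius_vertex n.+1 := U (Ordinal n2).
have cU i : connect (@moebius_adj n.+1) o (U i).
  case: i => i; elim: i => [|i IH] lti.
    by rewrite (_ : Ordinal lti = Ordinal n2) //; apply: val_inj.
  apply: connect_trans (IH (ltnW lti)) (connect1 _).
  by rewrite /moebius_adj /= /subscript /= eqxx.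
have cU' i : connect (@moebius_adj n.+1) o (U' i).
  case: i => i; elim: i => [|i IH] lti.
    apply: connect_trans (cU (Ordinal lti)) (connect1 _).
    by [].
  apply: connect_trans (IH (ltnW lti)) (connect1 _).
  by rewrite /moebius_adj /= /subscript /= eqxx.
have co x : connect (@moebius_adj n.+1) o x.
  case: x => [[i|i]|[k ltk]]; [exact: cU | exact: cU' |].
  have lt2k : (k.*2.+1 < n.+1.*2)%N by rewrite -doubleS leq_double.
  apply: connect_trans (cU (Ordinal lt2k)) (connect1 _).
  by rewrite /moebius_adj /= /subscript /= doubleS eqxx.
by apply/forallP => x; apply/forallP => y; apply: connect_trans (co y);
   rewrite csym.
Qed.

(* Main.v *)
(** Listing u_1, ..., u_2n, u'_1, ..., u'_2n around a cycle of length 4n, each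
    u_k is joined to its antipode u'_k by an edge or by a path of length 2
    through some w.  A geodesic therefore either follows the cycle or crosses
    once, which gives the closed form [mdist].  To verify it one checks that it
    changes by at most 1 along an edge and that every vertex other than the
    source has a neighbour that is closer.  In each block of the double sum the
    rows are rearrangements of one another, and the row sums reduce to sums of
    [minn d (m - d)]. *)
Require Import Defs.
From mathcomp Require Import all_boot all_order all_algebra.
From mathcomp Require Import zify lra.
Local Open Scope ring_scope.

(** * Recognising a distance function by local conditions *)

Section Distance.

Variable G : sgraph.
Implicit Types x y z : G.

Lemma walk0 x : walk 0 x x.
Proof. by apply/existsP; exists [tuple]; rewrite /= eqxx. Qed.

Lemma walk_rcons k x y z : walk k x y -> adj y z -> walk k.+1 x z.
Proof.
move=> /existsP[p /andP[pth /eqP lst]] yz.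
have sz : size (rcons p z) == k.+1 by rewrite size_rcons size_tuple.
by apply/existsP; exists (Tuple sz); rewrite /= rcons_path pth lst yz last_rcons eqxx.
Qed.

Lemma walk_connect k x y : walk k x y -> connect (@adj G) x y.
Proof.
by move=> /existsP[p /andP[pth /eqP lst]]; apply/connectP; exists p.
Qed.

(** The Lipschitz condition makes [f y] a lower bound for the length of any walk from [x] to [y];
    stepping repeatedly to a closer neighbour yields a walk of exactly that length. *)
Lemma dist_unique (f : G -> nat) x :
    f x = 0%N ->
    (forall y z, adj y z -> (f z <= (f y).+1)%N) ->
    (forall y, (forall z, adj y z -> (f y <= f z)%N) -> y = x) ->
  forall y, dist x y = f y.
Proof.
move=> fx lip desc y.
have low k z : walk k x z -> (f z <= k)%N.
  move=> /existsP[p /andP[pth /eqP <-]].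
  suff: (f (last x p) <= f x + size p)%N by rewrite fx size_tuple.
  elim: {p}(tval p) {1 2 3}x pth => [|a p IH] b /=; first by rewrite addn0.
  move=> /andP[ba /IH le]; apply: leq_trans le _.
  by rewrite addnS -addSn leq_add2r lip.
have upp k z : f z = k -> walk k x z.
  elim: k z => [|k IH] z fz.
    have -> := desc z _; first exact: walk0.
    by move=> t _; rewrite fz.
  have [/existsP[t /andP[zt ft]]|/existsPn no] :=
    boolP [exists t, adj z t && (f t < f z)%N].
    (* The Lipschitz condition forces the closer neighbour [t] to have [f t = k] exactly. *)
    apply: walk_rcons (IH t _) _; last by rewrite adj_sym.
    by have := lip t z; rewrite adj_sym => /(_ zt); lia.
  have zx : z = x.
    by apply: desc => t zt; have := no t; rewrite zt /= -leqNgt.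
  by move: fz; rewrite zx fx.
have wy := upp _ y erefl.
have [wd /(_ _ wy) led] := distP (walk_connect _ _ _ wy).
by apply/eqP; rewrite eqn_leq led low.
Qed.

End Distance.

(** * The closed form of the distance *)

Local Notation U i := (inl (inl i)).
Local Notation U' i := (inl (inr i)).
Local Notation W i := (inr i).

Local Open Scope nat_scope.

Definition gap (i j : nat) : nat := (i - j) + (j - i).

(** Both ends on one side: follow the cycle, or cross and walk [2n - d] steps. As [d < 2n], the
    latter route visits two consecutive indices, one of which is even and admits a crossing of cost
    1. *)
Definition along (n d : nat) : nat := minn d (n.*2.+1 - d).

(* At the antipode itself the crossing costs 2 rather than 1 if it runs through
   a vertex w; the flag [o] tells when this happens. *)
Definition across (n : nat) (o : bool) (d : nat) : nat :=
  minn d.+1 (n.*2 - d) + (o && (d == 0)).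

(** The two neighbours of a [w] are antipodal, hence at cycle distances [d] and [2n - d] from the
    other end. *)
Definition pendant (n d : nat) : nat := (minn d (n.*2 - d)).+1.

Definition pendants (n d : nat) : nat :=
  if d == 0 then 0 else (minn d (n - d)).*2.+2.

(* Indices count from 0, so [W k] is joined to [U i] and [U' i] for i = 2k+1. *)
Definition mdist {n} (x y : moebius_vertex n) : nat :=
  match x, y with
  | U i, U j | U' i, U' j => along n (gap i j)
  | U i, U' j | U' i, U j => across n (odd i) (gap i j)
  | U i, W k | U' i, W k | W k, U i | W k, U' i => pendant n (gap k.*2.+1 i)
  | W k, W l => pendants n (gap k l)
  end.

(** * Gaps, and the absence of nonzero local minima on the cycle *)

Lemma gapC i j : gap i j = gap j i.
Proof. exact: addnC. Qed.

Lemma gapxx i : gap i i = 0.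
Proof. by rewrite /gap subnn. Qed.

Lemma gap0r i : gap i 0 = i.
Proof. by rewrite /gap subn0 sub0n addn0. Qed.

Lemma gap_eq0 i j : (gap i j == 0) = (i == j).
Proof. by rewrite /gap addn_eq0 !subn_eq0 -eqn_leq. Qed.

Lemma gap_lt m p j : p < m -> j < m -> gap p j < m.
Proof. by rewrite /gap; lia. Qed.

Lemma gap_last m p : p < m -> gap p m.-1 = m.-1 - p.
Proof. by rewrite /gap; lia. Qed.

Lemma gap_odd k l : gap k.*2.+1 l.*2.+1 = (gap k l).*2.
Proof. by rewrite /gap !subSS -!doubleB doubleD. Qed.

(* [h] gives the distance to the source as a function of the gap on the side of
   the target [j], [h'] does so on the other side.  The neighbours of [j] on the
   cycle, possibly across the junction of the two sides, realise the values of
   [h] at both neighbouring gaps. *)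
Lemma gap_neighbours m p j (h h' : nat -> nat) : p < m -> j < m ->
    (forall d, d < m -> h' d = h (m - d)) ->
    (j.+1 < m -> h (gap p j) <= h (gap p j.+1)) ->
    (j.+1 = m -> h (gap p j) <= h' (gap p 0)) ->
    (0 < j -> h (gap p j) <= h (gap p j.-1)) ->
    (j = 0 -> h (gap p j) <= h' (gap p m.-1)) ->
  0 < gap p j ->
  h (gap p j) <= h (gap p j).-1 /\ h (gap p j) <= h (gap p j).+1.
Proof.
move=> pm jm hC nx nx' pv pv'; have [pj|jp|->] := ltngtP p j; last first.
- by rewrite /gap subnn.
- move=> gp; split.
    have -> : (gap p j).-1 = gap p j.+1 by rewrite /gap; lia.
    by apply: nx; lia.
  case: (posnP j) => [j0|j0].
    have -> : (gap p j).+1 = m - gap p m.-1 by rewrite /gap; lia.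
    by rewrite -hC; [exact: pv' | rewrite /gap; lia].
  have -> : (gap p j).+1 = gap p j.-1 by rewrite /gap; lia.
  exact: pv.
- move=> gp; split.
    have -> : (gap p j).-1 = gap p j.-1 by rewrite /gap; lia.
    by apply: pv; lia.
  case: (ltnP j.+1 m) => [jm1|jm1].
    have -> : (gap p j).+1 = gap p j.+1 by rewrite /gap; lia.
    exact: nx.
  have jm2 : j.+1 = m by lia.
  have -> : (gap p j).+1 = m - gap p 0 by rewrite /gap; lia.
  by rewrite -hC; [exact: nx' | rewrite /gap; lia].
Qed.

(** On the rising branch the value drops at [d - 1], on the falling one at [d + 1]; [d < b] keeps
    the falling branch from being truncated at 0. *)
Lemma tent_no_min a b d : 0 < d -> d < b ->
  minn (d + a) (b - d) <= minn (d.-1 + a) (b - d.-1) ->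
  minn (d + a) (b - d) <= minn (d.+1 + a) (b - d.+1) -> False.
Proof.
move=> d0 db; have [da|da] := leqP (d + a) (b - d).
  by move=> h _; have := leq_trans h (geq_minl _ _); lia.
by move=> _ h; have := leq_trans h (geq_minr _ _); lia.
Qed.

Lemma along_min n i j : 2 <= n -> i < n.*2 -> j < n.*2 ->
    (j.+1 < n.*2 -> along n (gap i j) <= along n (gap i j.+1)) ->
    (j.+1 = n.*2 -> along n (gap i j) <= across n (odd i) (gap i 0)) ->
    (0 < j -> along n (gap i j) <= along n (gap i j.-1)) ->
    (j = 0 -> along n (gap i j) <= across n (odd i) (gap i n.*2.-1)) ->
    (~~ odd j -> along n (gap i j) <= across n (odd i) (gap i j)) ->
  along n (gap i j) = 0.
Proof.
move=> n2 im jm nx nx' pv pv' op.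
have [->|gp] := posnP (gap i j); first by rewrite /along min0n.
have gm := gap_lt _ _ _ im jm.
(* With the flag off, [across] is the mirror image of [along]. *)
have [||| toward away] := @gap_neighbours n.*2 i j (along n)
  (across n false) im jm _ nx _ pv _ gp.
- move=> d dn; rewrite /across /along addn0 minnC; congr minn; lia.
- by move=> /nx'; rewrite /across gap0r; case: (i) => [|?] //; rewrite andbF.
(* The flag matters only for [i = 2n - 1]. There the rung at index 0 leads from distance 2 to
   distance 1, as [n >= 2]. *)
- move=> j0; subst j; have := pv' erefl; rewrite /across gap_eq0.
  have [/andP[_ /eqP ei] _|//] := boolP (odd i && (i == n.*2.-1)).
  move: (op isT) (gp); rewrite gap0r /across /along => + i0.
  by rewrite (gtn_eqF i0) andbF addn0 ei; lia.
case: (@tent_no_min 0 n.*2.+1 (gap i j)); rewrite ?addn0 // ltnW //.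
Qed.

(** Opposite sides are never at distance 0, so the hypotheses are contradictory; the conclusion has
    the shape that [mdist_descent] expects. *)
Lemma across_min n i j : 2 <= n -> i < n.*2 -> j < n.*2 ->
    (j.+1 < n.*2 ->
     across n (odd i) (gap i j) <= across n (odd i) (gap i j.+1)) ->
    (j.+1 = n.*2 -> across n (odd i) (gap i j) <= along n (gap i 0)) ->
    (0 < j -> across n (odd i) (gap i j) <= across n (odd i) (gap i j.-1)) ->
    (j = 0 -> across n (odd i) (gap i j) <= along n (gap i n.*2.-1)) ->
    (~~ odd j -> across n (odd i) (gap i j) <= along n (gap i j)) ->
    (odd j -> across n (odd i) (gap i j) <= pendant n (gap j./2.*2.+1 i)) ->
  across n (odd i) (gap i j) = 0.
Proof.
move=> n2 im jm nx nx' pv pv' op ow; exfalso.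
have gm := gap_lt _ _ _ im jm.
have [/eqP|gp] := posnP (gap i j).
  rewrite gap_eq0 => /eqP ij; subst j; have [oi|ei] := boolP (odd i).
    have ii : i./2.*2.+1 = i by rewrite -[RHS]odd_double_half oi.
    move: (ow oi); rewrite ii gapxx /across /pendant oi subn0 min0n.
    by rewrite (minn_idPl _) //; lia.
  by move: (op ei); rewrite gapxx /across /along subn0 min0n; lia.
have [|toward away] := @gap_neighbours n.*2 i j (across n (odd i)) (along n)
  im jm _ nx nx' pv pv' gp.
  move=> d dn; rewrite /across /along subn_eq0 leqNgt dn andbF addn0 minnC.
  by congr minn; lia.
(* At gap 1 the inner neighbour is the antipode, whose value the flag may raise. If it does, [i] is
   odd, so [j] is even and its rung leads closer. *)
have [g1|g1] := eqVneq (gap i j) 1.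
  have [oi|ei] := boolP (odd i).
    have /op : ~~ odd j by move: g1 oi; clear; rewrite /gap; lia.
    by rewrite g1 /across /along; lia.
  by move: toward; rewrite g1 /across (negPf ei) /= !addn0 subn0; lia.
case: (@tent_no_min 1 n.*2 (gap i j)) => //.
  move: toward; rewrite /across !addn1 (gtn_eqF gp).
  by rewrite [_.-1 == 0]gtn_eqF ?andbF ?addn0 //; lia.
by move: away; rewrite /across !addn1 (gtn_eqF gp) andbF !addn0.
Qed.

Lemma pendant_min n k j : k < n -> j < n.*2 ->
    (j.+1 < n.*2 -> pendant n (gap k.*2.+1 j) <= pendant n (gap k.*2.+1 j.+1)) ->
    (j.+1 = n.*2 -> pendant n (gap k.*2.+1 j) <= pendant n (gap k.*2.+1 0)) ->
    (0 < j -> pendant n (gap k.*2.+1 j) <= pendant n (gap k.*2.+1 j.-1)) ->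
    (j = 0 -> pendant n (gap k.*2.+1 j) <= pendant n (gap k.*2.+1 n.*2.-1)) ->
    (odd j -> pendant n (gap k.*2.+1 j) <= pendants n (gap k j./2)) ->
  pendant n (gap k.*2.+1 j) = 0.
Proof.
move=> kn jm nx nx' pv pv' ow; exfalso.
have km : k.*2.+1 < n.*2 by rewrite -doubleS leq_double.
have gm := gap_lt _ _ _ km jm.
have [/eqP|gp] := posnP (gap k.*2.+1 j).
  rewrite gap_eq0 => /eqP ij; subst j; move: ow.
  by rewrite /= odd_double uphalf_double !gapxx => /(_ isT).
have [|toward away] := @gap_neighbours n.*2 k.*2.+1 j (pendant n) (pendant n)
  km jm _ nx nx' pv pv' gp.
  by move=> d dn; rewrite /pendant minnC subKn // ltnW.
by case: (@tent_no_min 0 n.*2 (gap k.*2.+1 j)); rewrite ?addn0.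
Qed.

(** * The closed form changes by at most 1 along an edge *)

Definition close (a b : nat) : bool := (a <= b.+1) && (b <= a.+1).

Lemma closeC a b : close a b = close b a.
Proof. exact: andbC. Qed.

Lemma closeSS a b : close a.+1 b.+1 = close a b.
Proof. by []. Qed.

Lemma close_min a b a' b' : close a a' -> close b b' ->
  close (minn a b) (minn a' b').
Proof.
move=> /andP[aa a'a] /andP[bb b'b]; rewrite /close -!minnSS !leq_min.
by rewrite !geq_min aa a'a bb b'b !orbT.
Qed.

Lemma close_sub m a b : close a b -> close (m - a) (m - b).
Proof. by rewrite /close; lia. Qed.

Lemma close_along n d d' : close d d' -> close (along n d) (along n d').
Proof. by move=> dd; rewrite close_min // close_sub. Qed.

Lemma close_across n o d d' : 0 < n -> close d d' ->
  close (across n o d) (across n o d').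
Proof.
move=> n0 dd; rewrite /across.
have cc : close (minn d.+1 (n.*2 - d)) (minn d'.+1 (n.*2 - d')).
  by rewrite close_min // close_sub.
case: o => /=; last by rewrite !addn0.
(* With the flag on, only a passage between gaps 0 and 1 is new; the values are 2 and
   [minn 2 (2n - 1)]. *)
case: d d' dd cc => [|d] [|d'] dd cc; rewrite ?addn0 //.
- by rewrite /close leqnSn.
- by case: d' dd {cc} => // _; rewrite /close; lia.
- by case: d dd {cc} => // _; rewrite /close; lia.
Qed.

Lemma close_pendant n d d' : close d d' -> close (pendant n d) (pendant n d').
Proof. by move=> dd; rewrite /pendant closeSS close_min // close_sub. Qed.

Lemma close_gap p j : close (gap p j) (gap p j.+1).
Proof. by rewrite /close /gap; lia. Qed.

(** This serves the direct rungs. They occur at even indices only, so at gap 0 the source index is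
    even and its flag is off. *)
Lemma close_along_across n o d : (d = 0 -> ~~ o) ->
  close (along n d) (across n o d).
Proof.
move=> d0; have -> : across n o d = minn d.+1 (n.*2 - d).
  by rewrite /across; case: d d0 => [/(_ erefl)/negPf->|d _]; rewrite ?andbF /= addn0.
by rewrite close_min // /close; lia.
Qed.

Lemma close_along_pendant n d : close (along n d) (pendant n d).
Proof. by rewrite /along /pendant -minnSS close_min // /close; lia. Qed.

Lemma close_across_pendant n o d : 0 < n -> close (across n o d) (pendant n d).
Proof.
move=> n0; rewrite /across /pendant; case: d => [|d].
  by rewrite subn0 min0n (minn_idPl _) ?double_gt0 //; case: o.
by rewrite andbF addn0 -minnSS close_min // /close; lia.
Qed.

Lemma close_pendant_pendants n d : close (pendant n d.*2) (pendants n d).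
Proof.
rewrite /pendant /pendants -doubleB; case: eqP => [->|_]; first by rewrite min0n.
have -> : minn d.*2 (n - d).*2 = (minn d (n - d)).*2.
  by rewrite -!mul2n minnMr.
by rewrite /close; lia.
Qed.

(** At the junction of the two sides the direct and the crossing route exchange roles, hence the
    swap of the arguments of [minn]. *)
Lemma close_along_across_end n p : p < n.*2 ->
  close (along n (n.*2.-1 - p)) (across n (odd p) p).
Proof.
move=> pn; rewrite /across; have -> : odd p && (p == 0) = false.
  by case: (p) => [|?] //; rewrite andbF.
rewrite addn0 [minn p.+1 _]minnC close_min // /close; lia.
Qed.

Lemma close_across_along_end n p : 0 < n -> p < n.*2 ->
  close (across n (odd p) (n.*2.-1 - p)) (along n p).
Proof.
move=> n0 pn; rewrite /across; have [/andP[_]|_] := boolP (_ && _).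
  (* The flag is on only here, where the values are 2 and [minn (2n - 1) 2]. *)
  move=> e; have -> : p = n.*2.-1 by lia.
  by rewrite subnn subn0 /along /close; lia.
by rewrite addn0 /along [minn p _]minnC close_min // /close; lia.
Qed.

Lemma close_pendant_end n p : p < n.*2 ->
  close (pendant n (n.*2.-1 - p)) (pendant n p).
Proof.
by move=> pn; rewrite /pendant closeSS [minn p _]minnC close_min // /close; lia.
Qed.

Lemma mdist_arc n (x y z : moebius_vertex n) : 2 <= n -> moebius_arc y z ->
  close (mdist x y) (mdist x z).
Proof.
move=> n2; have n0 : 0 < n by apply: leq_trans n2.
have odd_lt k : k < n -> k.*2.+1 < n.*2 by rewrite -doubleS leq_double.
have last_eq j : j.+1 = n.*2 -> j = n.*2.-1 by move=> <-.
case: y => [[[j lj]|[j lj]]|[j lj]]; case: z => [[[k lk]|[k lk]]|[k lk]] //=;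
  rewrite /subscript /= ?eqSS.
- move=> /eqP e; subst k; case: x => [[[i li]|[i li]]|[i li]] /=.
  + exact/close_along/close_gap.
  + exact/close_across/close_gap.
  + exact/close_pendant/close_gap.
- case/orP => [/andP[/eqP/last_eq e /eqP e0]|/andP[ej /eqP e]]; subst.
    case: x => [[[i li]|[i li]]|[i li]] /=; rewrite gap0r gap_last ?odd_lt //.
    + exact: close_along_across_end.
    + exact: close_across_along_end.
    + exact/close_pendant_end/odd_lt.
  case: x => [[[i li]|[i li]]|[i li]] /=; last by rewrite /close leqnSn.
    apply: close_along_across => /eqP.
    by rewrite gap_eq0 => /eqP->.
  rewrite closeC; apply: close_along_across => /eqP.
  by rewrite gap_eq0 => /eqP->.
- move=> /eqP e; subst j.
  case: x => [[[i li]|[i li]]|[i li]] /=.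
  + by rewrite [gap _ i]gapC; exact: close_along_pendant.
  + by rewrite [gap _ i]gapC; exact: close_across_pendant.
  + by rewrite gap_odd; exact: close_pendant_pendants.
- case/andP => [/eqP/last_eq e /eqP e0]; subst.
  case: x => [[[i li]|[i li]]|[i li]] /=; rewrite gap0r gap_last ?odd_lt //.
  + exact: close_across_along_end.
  + exact: close_along_across_end.
  + exact/close_pendant_end/odd_lt.
- move=> /eqP e; subst k; case: x => [[[i li]|[i li]]|[i li]] /=.
  + exact/close_across/close_gap.
  + exact/close_along/close_gap.
  + exact/close_pendant/close_gap.
- move=> /eqP e; subst k.
  case: x => [[[i li]|[i li]]|[i li]] /=; rewrite closeC.
  + by rewrite [gap _ i]gapC; exact: close_across_pendant.
  + by rewrite [gap _ i]gapC; exact: close_along_pendant.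
  + by rewrite gap_odd; exact: close_pendant_pendants.
Qed.

(** * Descent to the source, and identification of the distance *)

Lemma mdist_eq0 n (x y : moebius_vertex n) : mdist x y = 0 -> y = x.
Proof.
have gap0 m (i j : 'I_m) : gap i j = 0 -> j = i.
  by move=> /eqP; rewrite gap_eq0 => /eqP/val_inj->.
have along0 (i j : 'I_n.*2) : along n (gap i j) = 0 -> j = i.
  move=> e; apply: gap0; move: e (gap_lt _ _ _ (ltn_ord i) (ltn_ord j)).
  by rewrite /along; lia.
have across0 o (i j : 'I_n.*2) : across n o (gap i j) = 0 -> False.
  move=> /eqP; have := gap_lt _ _ _ (ltn_ord i) (ltn_ord j).
  by rewrite /across addn_eq0 => ? /andP[/eqP ? _]; lia.
case: x => [[i|i]|i]; case: y => [[j|j]|j] //=.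
- by move/along0->.
- by move/across0.
- by move/across0.
- by move/along0->.
- by rewrite /pendants; case: eqP => // /gap0->.
Qed.

Lemma mdist_descent n (x y : moebius_vertex n) : 2 <= n ->
  (forall z, moebius_adj y z -> mdist x y <= mdist x z) -> mdist x y = 0.
Proof.
move=> n2; have n0 : 0 < n.*2 by rewrite double_gt0 ltnW.
(* The side is made a boolean, so that both sides share one list of neighbours and the junction
   negates it. *)
pose V b i : moebius_vertex n := if b then U' i else U i.
have onV b j : (forall z, moebius_adj (V b j) z -> mdist x (V b j) <= mdist x z) ->
    mdist x (V b j) = 0.
  case: j => j lj le.
  have nx (h : j.+1 < n.*2) : mdist x (V b (Ordinal lj)) <= mdist x (V b (Ordinal h)).
    by apply: le; case: (b); rewrite /moebius_adj /= /subscript /= eqxx.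
  have nx' : j.+1 = n.*2 ->
      mdist x (V b (Ordinal lj)) <= mdist x (V (~~ b) (Ordinal n0)).
    by move=> e; apply: le; case: (b); rewrite /moebius_adj /= /subscript /= e !eqxx.
  have pv (h : 0 < j) : mdist x (V b (Ordinal lj)) <=
      mdist x (V b (Ordinal (leq_ltn_trans (leq_pred j) lj))).
    by apply: le; case: (b); rewrite /moebius_adj /= /subscript /= prednK // eqxx orbT.
  have nN : n.*2.-1 < n.*2 by rewrite ltn_predL.
  have pv' : j = 0 ->
      mdist x (V b (Ordinal lj)) <= mdist x (V (~~ b) (Ordinal nN)).
    move=> e; apply: le; case: (b);
      by rewrite /moebius_adj /= /subscript /= prednK // e !eqxx ?orbT.
  have op : ~~ odd j ->
      mdist x (V b (Ordinal lj)) <= mdist x (V (~~ b) (Ordinal lj)).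
    move=> ej; apply: le; case: (b);
      by rewrite /moebius_adj /= /subscript /= ej eqxx ?orbT.
  have jn : j./2 < n by rewrite ltn_half_double.
  have ow : odd j -> mdist x (V b (Ordinal lj)) <= mdist x (W (Ordinal jn)).
    move=> oj; have ej : j./2.*2.+1 = j by rewrite -[RHS]odd_double_half oj.
    apply: le; case: (b);
      by rewrite /moebius_adj /= /subscript /= doubleS ej eqxx.
  clear le; case: b nx nx' pv pv' op ow; rewrite /V /=;
    case: x => [[[i li]|[i li]]|[i li]] /= nx nx' pv pv' op ow.
  1, 5: exact: (across_min _ _ _ n2 li lj).
  1, 3: exact: (along_min _ _ _ n2 li lj).
  1, 2: exact: (pendant_min _ _ _ li lj).
case: y => [[j|j]|[j lj] le]; [exact: (onV false)|exact: (onV true)|].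
have l2 : j.*2.+1 < n.*2 by rewrite -doubleS leq_double.
have lu : mdist x (W (Ordinal lj)) <= mdist x (U (Ordinal l2)).
  by apply: le; rewrite /moebius_adj /= /subscript /= doubleS eqxx.
have lu' : mdist x (W (Ordinal lj)) <= mdist x (U' (Ordinal l2)).
  by apply: le; rewrite /moebius_adj /= /subscript /= doubleS eqxx.
(* Of the two antipodal neighbours of a [w], the one on the shorter arc is closer to the source. *)
have no_min o d : pendant n d <= along n d -> pendant n d <= across n o d ->
    pendant n d = 0.
  rewrite /pendant /along /across; case: d => [|d]; first by rewrite !min0n.
  rewrite andbF addn0; have [dn|dn] := leqP d.+1 (n.*2 - d.+1).
    by move=> h _; have := leq_trans h (geq_minl _ _); rewrite ltnn.
  by move=> _ h; have := leq_trans h (geq_minr _ _); rewrite ltnn.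
move: lu lu'; clear le onV V.
case: x => [[[i li]|[i li]]|[i li]] /=.
- by rewrite [gap _ i]gapC; exact: no_min.
- by rewrite [gap _ i]gapC => h1 h2; exact: no_min h2 h1.
- rewrite gap_odd /pendant /pendants -doubleB => + _; case: eqP => // _.
  by rewrite -!mul2n -minnMr; lia.
Qed.

Lemma dist_moebius n (x y : pentagonal_moebius n) : 2 <= n ->
  dist x y = mdist x y.
Proof.
move=> n2; apply: dist_unique.
- by case: x => [[i|i]|k] /=; rewrite gapxx /along /pendants ?min0n.
- by move=> {}y z /orP[] /(@mdist_arc _ x _ _ n2) /andP[].
- by move=> {}y /(@mdist_descent _ _ _ n2) /mdist_eq0.
Qed.

(** * Degrees *)

Lemma sum_eq_ord m (b : bool) c :
  \sum_(j < m) (b && (j == c :> nat)) = b && (c < m).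
Proof.
have [lt_c|ge_c] := ltnP c m.
  rewrite (bigD1 (Ordinal lt_c)) //= eqxx big1 ?addn0 // => j.
  by rewrite -val_eqE /= => /negPf->; rewrite andbF.
rewrite andbF big1 // => j _.
by rewrite [_ == c]ltn_eqF ?andbF // (leq_trans (ltn_ord j)).
Qed.

Lemma degE (G : sgraph) (x : G) : deg x = \sum_y adj x y.
Proof. by rewrite /deg -sum1dep_card [LHS]big_mkcond; apply: eq_bigr => y _; case: adj. Qed.

Lemma big_vertex n (F : moebius_vertex n -> nat) :
  \sum_x F x = \sum_i F (U i) + \sum_i F (U' i) + \sum_k F (W k).
Proof. by rewrite !big_sumType. Qed.

Definition weight {n} (x : moebius_vertex n) : nat := if x is inr _ then 2 else 3.

Lemma deg_moebius n (x : pentagonal_moebius n) : 2 <= n ->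
  deg x = weight x.
Proof.
move=> n2; rewrite degE big_vertex /weight /= /moebius_adj.
(* Neighbours are counted on the own side, on the other side and among the [w], each as an indicator
   that [sum_eq_ord] evaluates. *)
pose same i : nat := \sum_(j < n.*2) (true && (j == i.+1 :> nat))
  + \sum_(j < n.*2) ((0 < i) && (j == i.-1 :> nat)).
pose other i : nat := \sum_(j < n.*2) ((i == n.*2.-1) && (j == 0 :> nat))
  + \sum_(j < n.*2) (~~ odd i && (j == i :> nat))
  + \sum_(j < n.*2) ((i == 0) && (j == n.*2.-1 :> nat)).
pose mid i : nat := \sum_(k < n) (odd i && (k == i./2 :> nat)).
have cycle3 i : i < n.*2 -> same i + other i + mid i = 3.
  by rewrite /same /other /mid !sum_eq_ord; lia.
case: x => [[[i li]|[i li]]|[k lk]]; rewrite /moebius_arc /subscript /=.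
- rewrite -(cycle3 _ li) /same /other /mid.
  by congr (_ + _ + _); rewrite -?big_split; apply: eq_bigr => -[j ?] _ /=; lia.
- rewrite -(cycle3 _ li) [same i + _]addnC /same /other /mid.
  by congr (_ + _ + _); rewrite -?big_split; apply: eq_bigr => -[j ?] _ /=; lia.
- transitivity (\sum_(j < n.*2) (true && (j == k.*2.+1 :> nat))
    + \sum_(j < n.*2) (true && (j == k.*2.+1 :> nat)) + 0).
    congr (_ + _ + _); last exact: big1.
    by apply: eq_bigr => -[j ?] _ /=; lia.
  by rewrite !sum_eq_ord; lia.
Qed.

(** * Row sums and the total *)

(** By the symmetry, [g (gap j p)] depends only on [j - p] modulo [m], so the row is a rotation of
    the values of [g]. *)
Lemma sum_gap m (g : nat -> nat) p : p < m ->
  (forall d, 0 < d < m -> g (m - d) = g d) ->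
  \sum_(j < m) g (gap j p) = \sum_(d < m) g d.
Proof.
move=> lt_pm gC; have le_pm := ltnW lt_pm.
rewrite -(big_mkord xpredT (fun j => g (gap j p))) -(big_mkord xpredT g).
rewrite (@big_cat_nat _ _ _ p) //= (@big_cat_nat _ _ _ (m - p) 0 m) ?leq_subr //=.
rewrite addnC; congr (_ + _).
  rewrite -{1}[p]add0n big_addn; apply: eq_bigr => d _.
  by congr g; rewrite /gap; lia.
rewrite -{1}[m - p]add0n big_addn subKn // big_nat [RHS]big_nat.
apply: eq_bigr => d /andP[_ lt_dp]; rewrite -gC; last by rewrite /gap; lia.
by congr g; rewrite /gap; lia.
Qed.

Lemma sum_minn m : \sum_(d < m) minn d (m - d) = m./2 * uphalf m.
Proof.
elim/ltn_ind: m => -[|[|m]] IH; rewrite ?big_ord0 //; first by rewrite big_ord1.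
rewrite big_ord_recl big_ord_recr /= min0n add0n.
(* Removing both end terms, 0 and 1, leaves the sum for [m] with each term raised by 1. *)
rewrite (eq_bigr (fun d : 'I_m => minn d (m - d) + 1)); last first.
  by move=> [d ?] _; rewrite /bump /=; lia.
rewrite big_split /= IH; last lia.
rewrite sum1_card card_ord /bump /=; nia.
Qed.

Lemma half_uphalf m : 4 * (m./2 * uphalf m) + odd m = m * m.
Proof.
have := odd_double_half m; rewrite uphalf_half.
by case: odd; move: m./2 => h <-; lia.
Qed.

(** The summand equals [2 * minn d (2n - d) + 1] except at [d = n], where it is one less. *)
Lemma sum_along_across n : 0 < n ->
  (\sum_(d < n.*2) (minn d (n.*2.+1 - d) + minn d.+1 (n.*2 - d))).+1
    = 2 * n * n + 2 * n.
Proof.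
move=> n0.
have <- : \sum_(d < n.*2) (2 * minn d (n.*2 - d) + 1) = 2 * n * n + 2 * n.
  rewrite big_split /= -big_distrr /= sum_minn sum1_card card_ord.
  by rewrite doubleK uphalf_double; lia.
have n_lt : n < n.*2 by lia.
rewrite (bigD1 (Ordinal n_lt)) //= [RHS](bigD1 (Ordinal n_lt)) //= -addSn.
congr (_ + _); first lia.
by apply: eq_bigr => -[d ?]; rewrite -val_eqE /=; lia.
Qed.

(** Replacing [d] by [2n - d] exchanges the two formulas, flag aside, so [sum_gap] applies to their
    sum. The flag contributes [odd i], at the antipode. *)
Lemma along_across_row n i : i < n.*2 ->
  \sum_(j < n.*2) along n (gap i j) + \sum_(j < n.*2) across n (odd i) (gap i j)
  = 2 * n * n + 2 * n - 1 + odd i.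
Proof.
move=> li; rewrite -big_split /=.
rewrite (eq_bigr (fun j : 'I_n.*2 =>
   (minn (gap j i) (n.*2.+1 - gap j i) + minn (gap j i).+1 (n.*2 - gap j i))
   + (odd i && (j == i :> nat)))); last first.
  by move=> j _; rewrite /along /across addnA gapC gap_eq0.
rewrite big_split /= sum_eq_ord li andbT.
rewrite (@sum_gap _ (fun d => minn d (n.*2.+1 - d) + minn d.+1 (n.*2 - d))) //.
  by rewrite -sum_along_across ?subSS ?subn0 //; lia.
by move=> d ?; lia.
Qed.

Lemma pendant_row n k : k < n ->
  \sum_(j < n.*2) pendant n (gap k.*2.+1 j) = n * n + 2 * n.
Proof.
move=> lk; under eq_bigr do rewrite gapC /pendant -addn1.
rewrite (@sum_gap _ (fun d => minn d (n.*2 - d) + 1)); first last.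
- by move=> d ?; lia.
- lia.
by rewrite big_split /= sum_minn sum1_card card_ord doubleK uphalf_double; lia.
Qed.

Lemma pendants_row n k : k < n ->
  \sum_(l < n) pendants n (gap k l) = 2 * n + 2 * (n./2 * uphalf n) - 2.
Proof.
move=> lk.
have -> : 2 * n + 2 * (n./2 * uphalf n)
    = \sum_(l < n) (2 + 2 * minn (gap l k) (n - gap l k)).
  rewrite (@sum_gap _ (fun d => 2 + 2 * minn d (n - d))) //; last by move=> d ?; lia.
  by rewrite big_split /= -big_distrr /= sum_minn sum_nat_const card_ord; lia.
rewrite (bigD1 (Ordinal lk)) //= [X in _ = X - _](bigD1 (Ordinal lk)) //= gapxx.
rewrite min0n muln0 addn0 add0n addKn; apply: eq_bigr => l.
by rewrite -val_eqE /pendants /= gapC gap_eq0 => /negPf->; rewrite -mul2n.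
Qed.

Lemma sum_odd n : \sum_(i < n.*2) odd i = n.
Proof.
elim: n => [|n IH]; first by rewrite big_ord0.
by rewrite doubleS !big_ord_recr /= IH odd_double /=; lia.
Qed.

(** The negative terms stand on the left to stay within [nat]; halving [26 + 2 * odd n] gives the
    coefficients 13 and 14. *)
Lemma sum_weighted_dist n : 2 <= n ->
  \sum_(x : moebius_vertex n) \sum_(y : moebius_vertex n)
      weight x * weight y * mdist x y + (26 + 2 * odd n) * n
    = 98 * n ^ 3 + 128 * n ^ 2.
Proof.
move=> n2; have n0 : 0 < n by lia.
pose rowU i := 9 * (2 * n * n + 2 * n - 1 + odd i) + 6 * \sum_(k < n) pendant n (gap k.*2.+1 i).
have rowUE : \sum_(i < n.*2) rowU i
    = 9 * (n.*2 * (2 * n * n + 2 * n - 1) + n) + 6 * (n * (n * n + 2 * n)).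
  rewrite big_split -!big_distrr /= big_split /= sum_nat_const card_ord sum_odd.
  (* [pendant_row] fixes [k] and sums over the cycle, so the order of summation is exchanged. *)
  rewrite exchange_big /= (eq_bigr (fun=> n * n + 2 * n)).
    by rewrite sum_nat_const card_ord.
  by move=> k _; rewrite pendant_row.
rewrite big_vertex.
rewrite (eq_bigr (fun i : 'I_n.*2 => rowU i)); last first.
  move=> i _; rewrite big_vertex /= -!big_distrr /= /rowU -mulnDr.
  by rewrite along_across_row.
rewrite [X in _ + X + _ + _](eq_bigr (fun i : 'I_n.*2 => rowU i)); last first.
  move=> i _; rewrite big_vertex /= -!big_distrr /= /rowU -mulnDr.
  by rewrite [X in _ * X + _]addnC along_across_row.
rewrite [X in _ + X + _](eq_bigr (fun=> 12 * (n * n + 2 * n)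
    + 4 * (2 * n + 2 * (n./2 * uphalf n) - 2))); last first.
  move=> k _; rewrite big_vertex /= -!big_distrr /= pendant_row //.
  by rewrite pendants_row // -mulnDl.
rewrite sum_nat_const card_ord rowUE.
have := half_uphalf n; move: (n./2 * _) (odd n : nat) => h o eh.
(* Multiplying by n lets the truncated subtractions be eliminated. *)
have ea : n * (2 * n * n + 2 * n - 1) + n = n * (2 * n * n + 2 * n).
  by rewrite mulnBr muln1 subnK // leq_pmulr //; lia.
have eb : n * (2 * n + 2 * h - 2) + n * 2 = n * (2 * n + 2 * h).
  by rewrite mulnBr subnK // leq_mul2l; lia.
(* Multiplied by [n], the relation [4 * h + o = n * n] eliminates the product [n * h] that the [w]
   rows contribute. *)
have := congr1 (muln n) eh; move: ea eb; rewrite -mul2n -!mulnA.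
move: (_ - 1) (_ - 2) => a b; lia.
Qed.

Local Open Scope ring_scope.

Theorem theorem9 (n : nat) (hn : (2 <= n)%N) :
  gutman (pentagonal_moebius n) =
    if odd n then 49 * n%:R ^+ 3 + 64 * n%:R ^+ 2 - 14 * n%:R
    else 49 * n%:R ^+ 3 + 64 * n%:R ^+ 2 - 13 * n%:R.
Proof.
rewrite /gutman.
rewrite (eq_bigr (fun x => (\sum_y weight x * weight y * mdist x y)%N%:R)); last first.
  move=> x _; rewrite GRing.natr_sum; apply: eq_bigr => y _.
  by rewrite dist_moebius // !deg_moebius.
rewrite -GRing.natr_sum.
have := congr1 (fun k => k%:R : rat) (sum_weighted_dist n hn).
rewrite /= !(GRing.natrD, GRing.natrM, GRing.natrX) => eS.
by case: odd eS => /=; lra.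
Qed.
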